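(* Let $f:\mathbb{C}^n\to\mathbb{R}\cup\{+\infty\}$ be a proper closed convex function (with $\mathbb{C}^n$ viewed as the real Euclidean space $\mathbb{R}^{2n}$ with inner product $\mathrm{Re}\,\mathbf{a}^\dagger\mathbf{b}$), let $\mathbf{D}\in\mathbb{C}^{m\times n}$, $\mathbf{b}\in\mathbb{C}^m$, and consider the problem $\min_{\mathbf{u}\in\mathbb{C}^n} f(\mathbf{u})$ s.t. $\mathbf{D}\mathbf{u}=\mathbf{b}$. Assume this problem admits a KKT pair, i.e. there exist $\mathbf{u}^\star\in\mathbb{C}^n$, $\bm\lambda^\star\in\mathbb{C}^m$ with $\mathbf{D}\mathbf{u}^\star=\mathbf{b}$ and $\mathbf{0}\in\partial f(\mathbf{u}^\star)+\mathbf{D}^\dagger\bm\lambda^\star$. Let $\{\omega_t\}_{t\ge 0}\subset(0,1]$ satisfy $\omega_0=1$ and $\sum_{t=0}^{\infty}\omega_t<+\infty$. Then, for any initial data $\mathbf{u}^0\in\mathbb{C}^n$, $\bm\lambda^0\in\mathbb{C}^m$, $\tau_{-1}>0$, $\theta>0$, $0<\underline{\eta}<\overline{\eta}$, the sequence $\{\mathbf{u}^t\}$ generated by the ABAL method (defined in the context) converges to an optimal solution $\mathbf{u}^*$ of the problem $\min f(\mathbf{u})$ s.t. $\mathbf{D}\mathbf{u}=\mathbf{b}$.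
   Context: For $\tau>0$, $\mathrm{prox}_{\tau f}(\mathbf{v}):=\arg\min_{\mathbf{u}\in\mathbb{C}^n}\{f(\mathbf{u})+\frac{1}{2\tau}\|\mathbf{u}-\mathbf{v}\|^2\}$. For real $a<c$, $\mathrm{proj}_{[a,c]}(s)=\min\{\max\{s,a\},c\}$ (with $\mathrm{proj}_{[a,c]}(+\infty)=c$). The ABAL method, given $\mathbf{u}^0,\bm\lambda^0,\{\omega_t\}$, an initial stepsize $\tau_{-1}>0$, $\theta>0$ and $0<\underline{\eta}<\overline{\eta}$, generates for $t=0,1,2,\dots$: $\widetilde{\mathbf{u}}^t=\mathbf{u}^t-\tau_{t-1}\mathbf{D}^\dagger\bm\lambda^t$, $\mathbf{u}^{t+1}=\mathrm{prox}_{\tau_{t-1}f}(\widetilde{\mathbf{u}}^t)$; $\eta_t=\mathrm{proj}_{[\underline{\eta},\overline{\eta}]}\big(\|\mathbf{u}^{t+1}\|/\|(\mathbf{u}^{t+1}-\widetilde{\mathbf{u}}^t;\ \theta\tau_{t-1}\bm\lambda^t)\|\big)$, where $(\mathbf{a};\mathbf{c})$ denotes the stacked vector and the ratio is interpreted as $+\infty$ if its denominator is zero and its numerator is positive, and as $0$ if the numerator is zero; $\kappa_t=1-\omega_t+\omega_t\eta_t$, $\tau_t=\kappa_t\tau_{t-1}$; $\mathbf{p}^{t+1}=\mathbf{D}\big(\mathbf{u}^{t+1}+\kappa_t(\mathbf{u}^{t+1}-\mathbf{u}^t)\big)-\mathbf{b}$; $\bm\lambda^{t+1}=\bm\lambda^t+\tau_t^{-1}(\mathbf{D}\mathbf{D}^\dagger+\theta^2\mathbf{I})^{-1}\mathbf{p}^{t+1}$.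 Here $\mathbf{D}^\dagger$ is the conjugate transpose and $\|\cdot\|$ the Euclidean norm. *)

(* Defs.v *)
From HB Require Import structures.
From mathcomp Require Import all_boot all_order all_algebra.
From mathcomp Require Import complex.
From mathcomp Require Import boolp classical_sets reals constructive_ereal ereal sequences.

Set Implicit Arguments.
Unset Strict Implicit.
Unset Printing Implicit Defensive.

Import Order.TTheory GRing.Theory Num.Theory.
Local Open Scope ring_scope.

Section ABAL.
Variable R : realType.
Local Notation C := (R[i]).
Local Notation vec k := ('cV[C]_k).

Definition herm (p q : nat) (A : 'M[C]_(p, q)) : 'M[C]_(q, p) :=
  (map_mx (@conjc R) A)^T.

Definition rinner (k : nat) (a c : vec k) : R :=
  complex.Re ((herm a *m c) 0 0).

Definition normv (k : nat) (a : vec k) : R := Num.sqrt (rinner a a).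

Definition rscale (k : nat) (s : R) (a : vec k) : vec k := (s%:C)%C *: a.

Definition vconverges (k : nat) (s : nat -> vec k) (l : vec k) : Prop :=
  forall e : R, 0 < e -> exists N : nat, forall t : nat, (N <= t)%N ->
    normv (s t - l) < e.

Definition proper_fun (k : nat) (f : vec k -> \bar R) : Prop :=
  (forall u, f u != -oo%E) /\ (exists u, (f u < +oo)%E).

Definition convex_fun (k : nat) (f : vec k -> \bar R) : Prop :=
  forall (u v : vec k) (a : R), 0 < a < 1 ->
    (f (rscale a u + rscale (1 - a) v)%R <= a%:E * f u + (1 - a)%R%:E * f v)%E.

(* closed: the epigraph {(u, r) | f u <= r} is closed (sequentially) *)
Definition closed_fun (k : nat) (f : vec k -> \bar R) : Prop :=
  forall (s : nat -> vec k) (r : nat -> R) (u : vec k) (a : R),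
    vconverges s u ->
    (forall e : R, 0 < e -> exists N : nat, forall t : nat, (N <= t)%N ->
        `|r t - a| < e) ->
    (forall t, (f (s t) <= (r t)%:E)%E) ->
    (f u <= a%:E)%E.

Definition subgrad (k : nat) (f : vec k -> \bar R) (u g : vec k) : Prop :=
  (f u < +oo)%E /\
  forall v : vec k, (f u + (rinner g (v - u)%R)%:E <= f v)%E.

Definition is_prox (k : nat) (tau : R) (f : vec k -> \bar R) (v u : vec k)
  : Prop :=
  forall w : vec k,
    (f u + ((2 * tau)^-1 * normv (u - v) ^+ 2)%R%:E
       <= f w + ((2 * tau)^-1 * normv (w - v) ^+ 2)%R%:E)%E.

Definition clamp (lo hi s : R) : R := Num.min (Num.max s lo) hi.

(* eta = proj_[lo,hi](num / den), with num/den := +oo if den = 0 < num,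
   and := 0 if num = 0 *)
Definition eta_of (lo hi num den : R) : R :=
  if num == 0 then clamp lo hi 0
  else if den == 0 then hi
  else clamp lo hi (num / den).

(* The ABAL iteration.  Indexing convention: tau t stands for tau_{t-1},
   so tau 0 = tau_{-1}. *)
Definition ABAL (n m : nat) (f : vec n -> \bar R) (D : 'M[C]_(m, n))
  (b : vec m) (omega : nat -> R) (theta lo hi : R)
  (u : nat -> vec n) (lam : nat -> vec m) (tau : nat -> R) : Prop :=
  forall t : nat,
    let ut := u t - rscale (tau t) (herm D *m lam t) in
    let eta := eta_of lo hi (normv (u t.+1))
                 (normv (col_mx (u t.+1 - ut) (rscale (theta * tau t) (lam t)))) in
    let kappa := 1 - omega t + omega t * eta in
    [/\ is_prox (tau t) f ut (u t.+1),
        tau t.+1 = kappa * tau t &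
        lam t.+1 = lam t + rscale (tau t.+1)^-1
          (invmx (D *m herm D + ((theta ^+ 2)%:C)%C%:M) *m
             (D *m (u t.+1 + rscale kappa (u t.+1 - u t)) - b))].

Definition optimal (n m : nat) (f : vec n -> \bar R) (D : 'M[C]_(m, n))
  (b : vec m) (u : vec n) : Prop :=
  D *m u = b /\ forall v : vec n, D *m v = b -> (f u <= f v)%E.

End ABAL.

(* Main.v *)
(* With D' the conjugate transpose of D, put
   Q(a, c) = |a - D'c|^2 + theta^2 |c|^2.  For a KKT pair (x, y), follow
   E_t = Q(u^t - x, tau_{t-1} (lambda^t - y)).  With the multiplier error
   scaled by the stepsize in this way, a step with kappa_t = 1 is firmly
   nonexpansive in Q whatever the stepsize, and replacing 1 by kappa_t perturbs
   it by O(omega_t) sqrt(E_t).  Hence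
   E_{t+1} <= (1 + C omega_t) E_t - d_t, where d_t >= 0 controls
   |u^{t+1} - u^t|^2 and |D u^{t+1} - b|^2.  Summability of omega keeps the
   iterates bounded, the stepsizes bounded away from 0 and infinity, and forces
   d_t -> 0, so every cluster point of (u^{t+1}, lambda^t) is a KKT pair.  The
   same inequality relative to such a cluster point shows that the whole
   sequence converges to it. *)
Require Import Defs.
From HB Require Import structures.
From mathcomp Require Import all_boot all_order all_algebra.
From mathcomp Require Import complex.
From mathcomp Require Import boolp classical_sets reals constructive_ereal ereal sequences.
From mathcomp Require Import topology normedtype exp.
From mathcomp Require Import ring lra.
Import Order.TTheory GRing.Theory Num.Theory.
Import numFieldNormedType.Exports.
Local Open Scope ring_scope.

Set Implicit Arguments.
Unset Strict Implicit.
Unset Printing Implicit Defensive.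

(** * Real inner product and squared norm on complex vectors *)

Section RealInnerProduct.
Variable R : realType.
Local Notation C := R[i].
Local Notation vec k := 'cV[C]_k.

Lemma rinnerE k (a c : vec k) : rinner a c =
  \sum_i (complex.Re (a i 0) * complex.Re (c i 0)
          + complex.Im (a i 0) * complex.Im (c i 0)).
Proof.
rewrite /rinner mxE raddf_sum; apply: eq_bigr => i _; rewrite !mxE.
by case: (a i 0) => x y; case: (c i 0) => z t /=; ring.
Qed.

Lemma rinnerC k (a c : vec k) : rinner a c = rinner c a.
Proof. by rewrite !rinnerE; apply: eq_bigr => i _; congr (_ + _); exact: mulrC. Qed.

Lemma rinnerDr k (a c d : vec k) : rinner a (c + d) = rinner a c + rinner a d.
Proof. by rewrite /rinner mulmxDr mxE raddfD. Qed.

Lemma rinnerDl k (a c d : vec k) : rinner (c + d) a = rinner c a + rinner d a.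
Proof. by rewrite ![rinner _ a]rinnerC rinnerDr. Qed.

Lemma rinnerNr k (a c : vec k) : rinner a (- c) = - rinner a c.
Proof. by rewrite /rinner mulmxN mxE raddfN. Qed.

Lemma rinnerNl k (a c : vec k) : rinner (- c) a = - rinner c a.
Proof. by rewrite ![rinner _ a]rinnerC rinnerNr. Qed.

Lemma rinnerZr k (s : R) (a c : vec k) : rinner a (rscale s c) = s * rinner a c.
Proof.
rewrite !rinnerE mulr_sumr; apply: eq_bigr => i _; rewrite !mxE.
by case: (c i 0) => x y /=; ring.
Qed.

Lemma rinnerZl k (s : R) (a c : vec k) : rinner (rscale s c) a = s * rinner c a.
Proof. by rewrite ![rinner _ a]rinnerC rinnerZr. Qed.

Definition rinner_lin := (rinnerDl, rinnerDr, rinnerNl, rinnerNr, rinnerZl, rinnerZr).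

Lemma hermM p q r (A : 'M[C]_(p, q)) (B : 'M[C]_(q, r)) :
  herm (A *m B) = herm B *m herm A.
Proof. by rewrite /herm map_mxM trmx_mul. Qed.

Lemma hermK p q (A : 'M[C]_(p, q)) : herm (herm A) = A.
Proof. by apply/matrixP => i j; rewrite !mxE conjcK. Qed.

Lemma rinner_adj p q (A : 'M[C]_(p, q)) (x : vec q) (y : vec p) :
  rinner (A *m x) y = rinner x (herm A *m y).
Proof. by rewrite /rinner hermM mulmxA. Qed.

Lemma rscaleDr k s (a c : vec k) : rscale s (a + c) = rscale s a + rscale s c.
Proof. exact: scalerDr. Qed.

Lemma rscaleBr k s (a c : vec k) : rscale s (a - c) = rscale s a - rscale s c.
Proof. exact: scalerBr. Qed.

Lemma rscaleA k s t (a : vec k) : rscale s (rscale t a) = rscale (s * t) a.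
Proof. by rewrite /rscale scalerA -rmorphM. Qed.

Lemma rscale1 k (a : vec k) : rscale 1 a = a.
Proof. exact: scale1r. Qed.

Lemma mulmx_rscale p q (A : 'M[C]_(p, q)) s x :
  A *m rscale s x = rscale s (A *m x).
Proof. by rewrite /rscale scalemxAr. Qed.

Definition sqn k (a : vec k) : R := rinner a a.

Lemma sqnE k (a : vec k) : sqn a =
  \sum_i (complex.Re (a i 0) ^+ 2 + complex.Im (a i 0) ^+ 2).
Proof. by rewrite /sqn rinnerE; apply: eq_bigr => i _; rewrite !expr2. Qed.

Lemma sqn_ge0 k (a : vec k) : 0 <= sqn a.
Proof. by rewrite sqnE; apply: sumr_ge0 => i _; rewrite addr_ge0 ?sqr_ge0. Qed.

Lemma normv_sqr k (a : vec k) : normv a ^+ 2 = sqn a.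
Proof. by rewrite /normv sqr_sqrtr ?sqn_ge0. Qed.

Lemma normv_ge0 k (a : vec k) : 0 <= normv a.
Proof. exact: sqrtr_ge0. Qed.

Lemma sqr_coord_le k (a : vec k) i :
  complex.Re (a i 0) ^+ 2 + complex.Im (a i 0) ^+ 2 <= sqn a.
Proof.
rewrite sqnE (bigD1 i) //= lerDl; apply: sumr_ge0 => j _.
by rewrite addr_ge0 ?sqr_ge0.
Qed.

Lemma sqn_eq0 k (a : vec k) : sqn a = 0 -> a = 0.
Proof.
move=> a0; apply/matrixP => i j; rewrite ord1 mxE.
have := sqr_coord_le a i; rewrite a0; case: (a i 0) => x y /= xy0.
have x0 : x = 0 by apply/eqP; rewrite -sqrf_eq0 eq_le; apply/andP; split; nra.
have y0 : y = 0 by apply/eqP; rewrite -sqrf_eq0 eq_le; apply/andP; split; nra.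
by rewrite x0 y0.
Qed.

Lemma sqnD k (a c : vec k) : sqn (a + c) = sqn a + 2 * rinner a c + sqn c.
Proof. by rewrite /sqn !rinner_lin (rinnerC c a); ring. Qed.

Lemma sqnZ k s (a : vec k) : sqn (rscale s a) = s ^+ 2 * sqn a.
Proof. by rewrite /sqn !rinner_lin; ring. Qed.

Lemma sqnN k (a : vec k) : sqn (- a) = sqn a.
Proof. by rewrite /sqn !rinner_lin opprK. Qed.

(** Expansion of the square of [w a - c], divided by [w]. The weight stays free because it is later
    taken equal to the relaxation parameter [omega t]. *)
Lemma young k w (a c : vec k) : 0 < w ->
  2 * rinner a c <= w * sqn a + w^-1 * sqn c.
Proof.
move=> w0; have := sqn_ge0 (rscale w a - c).
rewrite sqnD sqnZ sqnN !rinner_lin => h.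
rewrite -(ler_pM2l w0) mulrDr !mulrA divff ?gt_eqF // mul1r -expr2.
by lra.
Qed.

Lemma sqnD_young k w (a c : vec k) : 0 < w ->
  sqn (a + c) <= (1 + w) * sqn a + (1 + w^-1) * sqn c.
Proof. by move=> /young - /(_ _ a c); rewrite sqnD; lra. Qed.

Lemma sqnD_le k (a c : vec k) : sqn (a + c) <= 2 * sqn a + 2 * sqn c.
Proof. by have := sqnD_young a c ltr01; rewrite invr1; lra. Qed.

Lemma sqnB_le k (a c : vec k) : sqn (a - c) <= 2 * sqn a + 2 * sqn c.
Proof. by have := sqnD_le a (- c); rewrite sqnN. Qed.

Lemma sqn_col_mx p q (a : 'cV[R[i]]_p) (c : 'cV[R[i]]_q) :
  sqn (col_mx a c) = sqn a + sqn c.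
Proof.
rewrite !sqnE big_split_ord /=; congr (_ + _).
  by apply: eq_bigr => j _; rewrite col_mxEu.
by apply: eq_bigr => j _; rewrite col_mxEd.
Qed.

(** Induction over the columns, with [A *m x] written as the combination of the columns of [A] with
    weights [x j 0]: a further column [c] turns the constant [K] into [2 * sqn c + 2 * K]. *)
Lemma sqn_mulmx_bounded p q (A : 'M[C]_(p, q)) :
  exists2 K, 0 <= K & forall x, sqn (A *m x) <= K * sqn x.
Proof.
have sqn_scale (z : C) (v : vec p) :
    sqn (z *: v) = (complex.Re z ^+ 2 + complex.Im z ^+ 2) * sqn v.
  rewrite !sqnE mulr_sumr; apply: eq_bigr => i _; rewrite !mxE.
  by case: z (v i 0) => [x y] [x' y'] /=; ring.
suff: exists2 K, 0 <= K & forall x : vec q,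
    sqn (\sum_(j <- enum 'I_q) x j 0 *: col j A) <= K * sqn x.
  case=> K K0 HK; exists K => // x; have := HK x; rewrite big_enum /=.
  congr (sqn _ <= _); apply/matrixP => i j; rewrite ord1 summxE mxE.
  by apply: eq_bigr => l _; rewrite !mxE mulrC.
elim: (enum 'I_q) => [|j s [K K0 HK]].
  by exists 0 => // x; rewrite big_nil /sqn /rinner mulmx0 mxE mul0r.
exists (2 * sqn (col j A) + 2 * K) => [|x]; first by have := sqn_ge0 (col j A); lra.
rewrite big_cons; apply: (le_trans (sqnD_le _ _)); rewrite sqn_scale.
have := HK x; have := sqr_coord_le x j; have := sqn_ge0 (col j A).
move: (_ + complex.Im _ ^+ 2) => r; nra.
Qed.

End RealInnerProduct.

(** * The primal-dual metric and its firm nonexpansiveness inequality *)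

Section PrimalDualForm.
Variables (R : realType) (n m : nat) (D : 'M[R[i]]_(m, n)) (theta : R).
Hypothesis theta_gt0 : 0 < theta.
Local Notation vec k := 'cV[R[i]]_k.

Definition gram : 'M[R[i]]_m := D *m herm D + ((theta ^+ 2)%:C)%C%:M.

(** With the square expanded, this is the form of the block matrix with rows [(I, - herm D)] and
    [(- D, gram)], the usual preconditioner of a primal-dual proximal point step. *)
Definition pdform (a : vec n) (c : vec m) : R :=
  sqn (a - herm D *m c) + theta ^+ 2 * sqn c.

Lemma gram_mul (y : vec m) :
  gram *m y = D *m (herm D *m y) + rscale (theta ^+ 2) y.
Proof. by rewrite /gram mulmxDl mul_scalar_mx mulmxA. Qed.

Lemma rinner_gram (x y : vec m) : rinner x (gram *m y) =
  rinner (herm D *m x) (herm D *m y) + theta ^+ 2 * rinner x y.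
Proof. by rewrite gram_mul !rinner_lin rinner_adj hermK. Qed.

(** [gram] is Hermitian, so a row in its left kernel gives a vector [x] with [gram *m x = 0];
    pairing with [x] makes [theta ^+ 2 * sqn x] vanish by [rinner_gram]. *)
Lemma gram_unit : gram \in unitmx.
Proof.
rewrite unitmxE unitfE; apply/negP => /det0P [v v0 vM].
have herm_gram : herm gram = gram.
  apply/matrixP => i j; rewrite /gram /herm !mxE rmorphD rmorph_sum /=.
  congr (_ + _); last by rewrite eq_sym rmorphMn /= oppr0.
  apply: eq_bigr => l _; rewrite !mxE rmorphM mulrC /=; congr (_ * _).
  exact: conjcK.
have Mv : gram *m herm v = 0.
  by rewrite -herm_gram -hermM vM /herm raddf0 trmx0.
have := rinner_gram (herm v) (herm v); rewrite Mv.
rewrite {1}/rinner mulmx0 mxE /= -!/(sqn _) => h.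
have s0 : sqn (herm v) = 0.
  have t0 : 0 < theta ^+ 2 by rewrite exprn_gt0.
  apply/eqP; rewrite -(mulrI_eq0 _ (mulfI (lt0r_neq0 t0))) eq_le.
  by rewrite mulr_ge0 ?sqr_ge0 ?sqn_ge0 // andbT [X in _ <= X]h lerDr sqn_ge0.
move/eqP: v0; apply; rewrite -[v]hermK (sqn_eq0 s0).
by rewrite /herm raddf0 trmx0.
Qed.

Lemma pdform_ge0 a c : 0 <= pdform a c.
Proof. by rewrite addr_ge0 ?sqn_ge0 ?(mulr_ge0 (sqr_ge0 _)) ?sqn_ge0. Qed.

Lemma sqn_dual_le a c : theta ^+ 2 * sqn c <= pdform a c.
Proof. by rewrite /pdform lerDr sqn_ge0. Qed.

(** The metric is equivalent to the Euclidean one: [theta] controls [c], and then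
    [a = (a - herm D *m c) + herm D *m c] controls [a]. The constants are added up so that a single
    [K] serves every estimate. *)
Lemma pdform_bounds : exists2 K, 0 <= K & forall a c,
  [/\ sqn a <= K * pdform a c, sqn c <= K * pdform a c,
      sqn (D *m a) <= K * pdform a c, sqn (gram *m c) <= K * pdform a c
    & pdform a c <= K * (sqn a + sqn c)].
Proof.
have [K1 K10 H1] := sqn_mulmx_bounded (herm D).
have [K2 K20 H2] := sqn_mulmx_bounded D.
have [K3 K30 H3] := sqn_mulmx_bounded gram.
have t0 : 0 < theta ^+ 2 by rewrite exprn_gt0.
set L := (theta ^+ 2)^-1; have L0 : 0 < L by rewrite invr_gt0.
set Ka := 2 + 2 * (K1 * L).
have Ka0 : 0 <= Ka by rewrite /Ka; nra.
have Hc a c : sqn c <= L * pdform a c.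
  by rewrite mulrC -ler_pdivrMr ?invr_gt0// invrK mulrC sqn_dual_le.
have Ha a c : sqn a <= Ka * pdform a c.
  rewrite -[X in sqn X](subrK (herm D *m c)).
  apply: (le_trans (sqnD_le _ _)).
  have : sqn (a - herm D *m c) <= pdform a c.
    by rewrite /pdform lerDl mulr_ge0 ?sqn_ge0 // ltW.
  have := Hc a c; have := H1 c; have := sqn_ge0 c; rewrite /Ka.
  move: (pdform a c) => q; nra.
exists (Ka + L + K2 * Ka + K3 * L + (2 + 2 * K1 + theta ^+ 2)) => [|a c].
  by rewrite !addr_ge0 ?mulr_ge0 // ltW.
have q0 := pdform_ge0 a c; have ha := Ha a c; have hc := Hc a c.
have P1 : 0 <= K2 * Ka by rewrite mulr_ge0.
have P2 : 0 <= K3 * L by rewrite mulr_ge0 // ltW.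
have h2 : sqn (D *m a) <= K2 * Ka * pdform a c.
  by apply: (le_trans (H2 a)); rewrite -mulrA ler_wpM2l.
have h3 : sqn (gram *m c) <= K3 * L * pdform a c.
  by apply: (le_trans (H3 c)); rewrite -mulrA ler_wpM2l.
have h4 : pdform a c <= (2 + 2 * K1 + theta ^+ 2) * (sqn a + sqn c).
  have := sqnB_le a (herm D *m c); have := H1 c.
  have := sqn_ge0 a; have := sqn_ge0 c; rewrite /pdform.
  move: (theta ^+ 2) t0 (sqn _) => T T0 z; nra.
have s0 : 0 <= sqn a + sqn c by rewrite addr_ge0 ?sqn_ge0.
have T0 := ltW t0.
move: (theta ^+ 2) T0 h4 => T T0 h4.
move: (K2 * Ka) (K3 * L) P1 P2 h2 h3 => K4 K5 P1 P2 h2 h3.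
by split; nra.
Qed.

Lemma pdformD_young w a c a' c' : 0 < w ->
  pdform (a + a') (c + c') <= (1 + w) * pdform a c + (1 + w^-1) * pdform a' c'.
Proof.
move=> w0; rewrite /pdform.
have -> : a + a' - herm D *m (c + c') = (a - herm D *m c) + (a' - herm D *m c').
  by rewrite mulmxDr opprD addrACA.
have := sqnD_young (a - herm D *m c) (a' - herm D *m c') w0.
have := sqnD_young c c' w0; have : 0 <= theta ^+ 2 by rewrite sqr_ge0.
by move: (theta ^+ 2) => T T0; nra.
Qed.

Lemma pdformZ s a c : pdform (rscale s a) (rscale s c) = s ^+ 2 * pdform a c.
Proof. by rewrite /pdform mulmx_rscale -rscaleBr !sqnZ; ring. Qed.

(* One step of the method with frozen stepsize is the resolvent of a monotone
   operator in the metric [pdform]. *)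
Lemma pdform_firm (A A' : vec n) (B G : vec m) :
  0 <= rinner A' (A - A' - herm D *m B) ->
  gram *m G = D *m (A' + (A' - A)) ->
  pdform A' (B + G) + pdform (A' - A) G <= pdform A B.
Proof.
move=> mono HG.
(* The loss in the inequality is exactly twice the monotonicity term. The identity is linear in the
   equation for [gram *m G] paired with [B] and with [G]. *)
suff -> : pdform A B = pdform A' (B + G) + pdform (A' - A) G
    + 2 * rinner A' (A - A' - herm D *m B) by rewrite lerDl; lra.
have e1 : rinner B (gram *m G) = rinner B (D *m (A' + (A' - A))) by rewrite HG.
have e2 : rinner G (gram *m G) = rinner G (D *m (A' + (A' - A))) by rewrite HG.
have adj (y : vec m) x : rinner y (D *m x) = rinner (herm D *m y) x.
  by rewrite rinner_adj hermK.
move: e1 e2; rewrite !rinner_gram !adj /pdform /sqn !mulmxDr !rinner_lin.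
rewrite (rinnerC A (herm D *m B)) (rinnerC A (herm D *m G)) (rinnerC A A').
rewrite (rinnerC A' (herm D *m B)) (rinnerC A' (herm D *m G)) (rinnerC G B).
rewrite (rinnerC (herm D *m G) (herm D *m B)) => e1 e2.
lra.
Qed.

End PrimalDualForm.

(** * Real sequences: null limits and recursions with summable perturbation *)

Section RealSequences.
Variable R : realType.
Local Open Scope classical_set_scope.

Lemma cvg0_squeeze (a c : nat -> R) :
  (forall k, 0 <= a k <= c k) -> c @ \oo --> 0 -> a @ \oo --> 0.
Proof.
move=> ac c0; apply: (@squeeze_cvgr _ _ _ _ (fun=> 0) c) => //.
- by apply: nearW => k; exact: ac.
- exact: cvg_cst.
Qed.

Lemma cvg0_sqr (a : nat -> R) : (fun k => a k ^+ 2) @ \oo --> 0 -> a @ \oo --> 0.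
Proof.
move=> /cvgrPdist_lt a0; apply/cvgrPdist_lt => e e0.
have := a0 (e ^+ 2) ltac:(by rewrite exprn_gt0).
apply: filterS => k; rewrite !sub0r !normrN normrX ltr_pXn2r //.
by rewrite nnegrE ltW.
Qed.

Lemma cvg0_comp (a : nat -> R) (phi : nat -> nat) :
  (forall k, (k <= phi k)%N) -> a @ \oo --> 0 -> (a \o phi) @ \oo --> 0.
Proof.
move=> hphi a0; apply: (cvg_comp phi a _ a0).
move=> P [N _ NP]; exists N => // k /= Nk; apply: NP => /=.
exact: leq_trans Nk (hphi k).
Qed.

Lemma cvg0_comb (x y : R) (a c : nat -> R) : a @ \oo --> 0 -> c @ \oo --> 0 ->
  (fun j => x * a j + y * c j) @ \oo --> 0.
Proof.
move=> a0 c0; rewrite -[0 in X in _ --> X](addr0 0).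
rewrite -[X in _ --> X + _](mulr0 x) -[X in _ --> _ + X](mulr0 y).
by apply: cvgD; apply: cvgM => //; exact: cvg_cst.
Qed.

Lemma cvg_eps (a : nat -> R) (l : R) : a @ \oo --> l ->
  forall e, 0 < e -> exists N, forall t, (N <= t)%N -> `|a t - l| < e.
Proof.
move=> /cvgrPdist_lt h e /h [N _ hN]; exists N => t Nt.
by rewrite distrC; exact: hN.
Qed.

Lemma cvg_sum0 (d : nat -> R) S : (forall t, 0 <= d t) ->
  (forall N, \sum_(0 <= t < N) d t <= S) -> d @ \oo --> 0.
Proof.
move=> d0 dS; apply: cvg_series_cvg_0; apply: nondecreasing_is_cvgn.
  by apply/nondecreasing_seqP => N; rewrite /series /= big_nat_recr //= lerDl.
by exists S => _ [N _ <-]; exact: dS.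
Qed.

(** The factors [1 + C * w t] are bounded by exponentials, whose product is at most [expR (C * S)].
    The constant [P] is chosen before the sequence and the starting index [N], so smallness at one
    late index persists afterwards. *)
Lemma summable_growth (w : nat -> R) S C : (forall t, 0 <= w t) ->
  (forall N, \sum_(0 <= t < N) w t <= S) -> 0 <= C ->
  exists2 P, 0 < P & forall a : nat -> R, (forall t, 0 <= a t) ->
    (forall t, a t.+1 <= (1 + C * w t) * a t) ->
    forall N t, (N <= t)%N -> a t <= P * a N.
Proof.
move=> w0 wS C0; exists (expR (C * S)) => [|a a0 ha N t /subnKC <-].
  exact: expR_gt0.
have step j : a (N + j)%N <= expR (C * \sum_(N <= i < N + j) w i) * a N.
  elim: j => [|j IH]; first by rewrite addn0 big_geq // mulr0 expR0 mul1r.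
  rewrite addnS; apply: (le_trans (ha _)).
  rewrite big_nat_recr ?leq_addr //= mulrDr expRD mulrAC [leRHS]mulrC.
  by apply: ler_pM; rewrite ?expR_ge1Dx // addr_ge0 ?mulr_ge0.
apply: (le_trans (step _)); apply: ler_wpM2r => //; rewrite ler_expR.
apply: ler_wpM2l => //; apply: le_trans (wS (N + (t - N))%N).
by rewrite [leRHS](@big_cat_nat _ _ _ N) ?leq_addr //= lerDr sumr_ge0.
Qed.

(** Once [a] is bounded by [summable_growth], the perturbation is at most [K * w t]; telescoping
    then bounds the partial sums of [d] by [a 0 + K * S]. *)
Lemma summable_descent (w : nat -> R) S C (a d : nat -> R) :
  (forall t, 0 <= w t) -> (forall N, \sum_(0 <= t < N) w t <= S) -> 0 <= C ->
  (forall t, 0 <= a t) -> (forall t, 0 <= d t) ->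
  (forall t, a t.+1 <= (1 + C * w t) * a t - d t) ->
  d @ \oo --> 0.
Proof.
move=> w0 wS C0 a0 d0 ha.
have [P P0 hP] := summable_growth w0 wS C0.
have aP t : a t <= P * a 0%N.
  by apply: hP => // {}t; apply: (le_trans (ha t)); rewrite gerBl.
set K := C * (P * a 0%N).
have K0 : 0 <= K by rewrite !mulr_ge0 // ltW.
apply: (@cvg_sum0 _ (a 0%N + K * S)) => // N.
have : \sum_(0 <= t < N) d t <= a 0%N - a N + K * \sum_(0 <= t < N) w t.
  elim: N => [|N IH]; first by rewrite !big_geq // subrr mulr0 addr0.
  rewrite !big_nat_recr //= mulrDr.
  have := ha N; have : C * w N * a N <= K * w N.
    by rewrite /K [leRHS]mulrAC ler_wpM2l // mulr_ge0.
  lra.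
move=> /le_trans -> //; have := ler_wpM2l K0 (wS N); have := a0 N; lra.
Qed.

End RealSequences.

(** * Convergence and compactness for complex vectors *)

Section VectorSequences.
Variable R : realType.
Local Notation vec k := 'cV[R[i]]_k.
Local Open Scope classical_set_scope.

Lemma vconverges_sqn k (s : nat -> 'cV[R[i]]_k) l :
  (fun t => sqn (s t - l)) @ \oo --> (0 : R) -> vconverges s l.
Proof.
move=> /cvg_eps h e e0; have [N hN] := h _ (exprn_gt0 2 e0).
exists N => t /hN; rewrite subr0 ger0_norm ?sqn_ge0 // -normv_sqr.
by rewrite ltr_pXn2r // nnegrE ?normv_ge0 // ltW.
Qed.

Lemma rinner_CS k (a c : vec k) : rinner a c ^+ 2 <= sqn a * sqn c.
Proof.
have [c0|c0] := eqVneq (sqn c) 0.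
  by rewrite (sqn_eq0 c0) /sqn /rinner !mulmx0 mxE expr0n /= mulr0.
have cp : 0 < sqn c by rewrite lt_def c0 sqn_ge0.
(* This square equals [sqn c * (sqn a * sqn c - rinner a c ^+ 2)]. *)
have := sqn_ge0 (rscale (sqn c) a - rscale (rinner a c) c).
rewrite sqnD sqnN !sqnZ !rinner_lin => h.
by rewrite -(ler_pM2l cp) -subr_ge0; lra.
Qed.

(** Both arguments are expanded around their limits; the three terms containing a difference vanish
    by Cauchy-Schwarz. *)
Lemma cvg_rinner k (a c : nat -> vec k) a0 c0 :
  (fun t => sqn (a t - a0)) @ \oo --> (0 : R) ->
  (fun t => sqn (c t - c0)) @ \oo --> (0 : R) ->
  (fun t => rinner (a t) (c t)) @ \oo --> rinner a0 c0.
Proof.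
move=> ha hc.
have small (x y : nat -> vec k) :
    (fun t => sqn (x t) * sqn (y t)) @ \oo --> (0 : R) ->
    (fun t => rinner (x t) (y t)) @ \oo --> (0 : R).
  move=> xy; apply: cvg0_sqr; apply: cvg0_squeeze xy => t.
  by rewrite sqr_ge0 rinner_CS.
have h1 : (fun t => rinner (a t - a0) (c t - c0)) @ \oo --> (0 : R).
  by apply: small; rewrite -[0 in X in _ --> X](mulr0 0); exact: cvgM.
have h2 : (fun t => rinner (a t - a0) c0) @ \oo --> (0 : R).
  apply: small; rewrite -[0 in X in _ --> X](mul0r (sqn c0)).
  by apply: cvgM => //; exact: cvg_cst.
have h3 : (fun t => rinner a0 (c t - c0)) @ \oo --> (0 : R).
  apply: small; rewrite -[0 in X in _ --> X](mulr0 (sqn a0)).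
  by apply: cvgM => //; exact: cvg_cst.
have -> : (fun t => rinner (a t) (c t)) = (fun t => rinner (a t - a0) (c t - c0)
    + rinner (a t - a0) c0 + rinner a0 (c t - c0) + rinner a0 c0).
  by apply/funext => t; rewrite !rinner_lin; ring.
rewrite -[X in _ --> X]add0r -{1}[0]add0r -{1}[0]add0r.
apply: cvgD; last exact: cvg_cst.
by apply: cvgD => //; exact: cvgD.
Qed.

(** Bolzano-Weierstrass, through compactness of a box in the [k + k] real coordinates. The condition
    [j <= phi j] makes [phi] tend to infinity, which is what [cvg0_comp] asks of a subsequence. *)
Lemma bounded_cvg_extraction k (s : nat -> vec k) K :
  (forall t, sqn (s t) <= K) -> exists (phi : nat -> nat) (l : vec k),
    (forall j, (j <= phi j)%N) /\
    (fun j => sqn (s (phi j) - l)) @ \oo --> (0 : R).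
Proof.
move=> sK.
pose coords t : 'rV[R]_(k + k) :=
  \row_j match split j with inl i => complex.Re (s t i 0)
                          | inr i => complex.Im (s t i 0) end.
pose box : set 'rV[R]_(k + k) :=
  [set v | forall j, `[- (1 + K), 1 + K] (v ord0 j)].
have box_compact : compact box.
  apply: (@rV_compact R _ (fun=> `[- (1 + K), 1 + K])) => _.
  exact: segment_compact.
have coordsP t : box (coords t).
  move=> j /=; rewrite mxE in_itv /= -ler_norml.
  have K0 : 0 <= K by exact: le_trans (sqn_ge0 _) (sK 0%N).
  have le1 (x : R) : x ^+ 2 <= K -> `|x| <= 1 + K.
    by move=> xK; rewrite ler_norml; apply/andP; split; nra.
  by case: splitP => i _; apply: le1; apply: le_trans (sK t);
    apply: le_trans (sqr_coord_le _ i); rewrite ?lerDl ?lerDr sqr_ge0.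
have coords_box : (coords @ \oo) box by apply: (@nearW _ \oo); exact: coordsP.
have [v [_ vcl]] := box_compact (coords @ \oo) _ coords_box.
pose l : vec k := \col_i Complex (v 0 (lshift k i)) (v 0 (rshift k i)).
(* In the sup-norm ball of radius [e = 1 / (j + 1)] around the cluster point, each of the [2 * k]
   squared coordinates is at most [e], as [e <= 1]. *)
have ex j : exists t, (j <= t)%N /\ sqn (s t - l) <= (2 * k)%:R * j.+1%:R^-1.
  have e0 : 0 < j.+1%:R^-1 :> R by rewrite invr_gt0 ltr0n.
  have [] := vcl [set coords t | t in [set t | (j <= t)%N]]
      (ball v (j.+1%:R^-1)).
  - by exists j => // t /= jt; exists t.
  - exact: nbhsx_ballx.
  move=> _ [[t /= jt <-] vt]; exists t; split => //.
  have e1 : j.+1%:R^-1 <= 1 :> R by rewrite invf_le1 ?ltr0n // ler1n.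
  have near0 i : `|v 0 i - coords t 0 i| < j.+1%:R^-1 by case: vt => _ /(_ 0 i).
  have sq (x : R) : `|x| < j.+1%:R^-1 -> x ^+ 2 <= j.+1%:R^-1.
    by move: (_^-1) e0 e1 => e ? ?; rewrite ltr_norml => /andP[]; nra.
  rewrite mulnC natrM -mulrA -[k in k%:R]card_ord mulr_natl -sumr_const sqnE.
  apply: ler_sum => i _; rewrite !mxE mulr_natl mulr2n.
  have := sq _ (near0 (lshift k i)); have := sq _ (near0 (rshift k i)).
  rewrite !mxE (unsplitK (inl i)) (unsplitK (inr i)) -![(v 0 _ - _) ^+ 2]sqrrN !opprB.
  by case: (s t i 0) => x y /= ? ?; apply: lerD.
have [phi hphi] := choice ex.
exists phi, l; split => [j|]; first by have [] := hphi j.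
apply: (@cvg0_squeeze _ _ (fun j => (2 * k)%:R * j.+1%:R^-1)).
  by move=> j; rewrite sqn_ge0; have [] := hphi j.
rewrite -[0 in X in _ --> X](mulr0 (2 * k)%:R).
by apply: cvgM; [exact: cvg_cst | exact: cvg_harmonic].
Qed.

End VectorSequences.

(** * Proximal points and monotonicity of the subdifferential *)

Section ProximalStep.
Variable R : realType.
Local Notation vec k := 'cV[R[i]]_k.

(** Divide by [a] and let [a] tend to 0. *)
Lemma le_of_quadratic (X Y Z : R) :
  (forall a, 0 < a < 1 -> a * X <= a * Y + a ^+ 2 * Z) -> X <= Y.
Proof.
move=> h; apply/ler_addgt0Pr => e e0.
set a := Num.min (1 / 2) (e / (1 + `|Z|)).
have z0 : 0 < 1 + `|Z| by rewrite ltr_wpDr.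
have a0 : 0 < a by rewrite lt_min !divr_gt0.
have a1 : a < 1 by rewrite gt_min; apply/orP; left; lra.
have aZ : a * Z <= e.
  have : a * (1 + `|Z|) <= e by rewrite -ler_pdivlMr // ge_min lexx orbT.
  have := ler_norm Z; nra.
have := h a; rewrite a0 a1 => /(_ isT).
by rewrite expr2 -mulrA -mulrDr ler_pM2l //; lra.
Qed.

(** Minimality of [p] is tested at [p + a (w - p)] and combined with convexity. The proximal term
    leaves a remainder quadratic in [a], which [le_of_quadratic] removes. *)
Lemma prox_subgrad k (f : vec k -> \bar R) tau v p :
  proper_fun f -> convex_fun f -> 0 < tau -> is_prox tau f v p ->
  subgrad f p (rscale tau^-1 (v - p)).
Proof.
move=> [fN [w0 fw0]] fconv tau0 hp.
have fp : (f p < +oo)%E.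
  have := hp w0; move: (fN w0) fw0 (fN p).
  by case: (f w0) => // r _ _; case: (f p) => // r' _; rewrite ltry.
split=> // w; move: (fN p) (fN w) fp (fconv w p).
case Efp: (f p) => [p0| |] //; case Efw: (f w) => [r| |] // _ _ _ hc; last first.
  by rewrite leey.
rewrite -EFinD lee_fin.
have -> : rinner (rscale tau^-1 (v - p)) (w - p)
    = (2 * tau)^-1 * (2 * rinner (v - p) (w - p)).
  by rewrite rinnerZl invfM; field; rewrite gt_eqF.
rewrite addrC -lerBrDr; apply: (@le_of_quadratic _ _ ((2 * tau)^-1 * sqn (w - p))) => a a01.
have := hc a a01; set z := rscale a w + _.
have := hp z; rewrite Efp !normv_sqr -EFinM -EFinM -EFinD; move: (fN z).
case: (f z) => [z0| |] // _; rewrite -?EFinD !lee_fin.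
have -> : z - v = (p - v) + rscale a (w - p).
  by apply/matrixP => i j; rewrite !mxE; ring.
have -> : v - p = - (p - v) by rewrite opprB.
rewrite (sqnD (p - v)) sqnZ rinnerNl rinnerZr.
move: (_^-1) (sqn _) (sqn _) (rinner _ _) => T x y c; lra.
Qed.

(** Monotonicity of the subdifferential between [p] and [us], multiplied by [tau]. The form is that
    of the monotonicity premise of [pdform_firm] with [A = u - us], [A' = p - us] and
    [B = rscale tau (l - ls)]. *)
Lemma prox_kkt_monotone n m (f : vec n -> \bar R) (D : 'M[R[i]]_(m, n))
    tau u p us (l ls : vec m) :
  proper_fun f -> convex_fun f -> 0 < tau ->
  is_prox tau f (u - rscale tau (herm D *m l)) p ->
  subgrad f us (- (herm D *m ls)) ->
  0 <= rinner (p - us)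
         ((u - us) - (p - us) - herm D *m rscale tau (l - ls)).
Proof.
move=> fp fc tau0 /(prox_subgrad fp fc tau0) [fp_fin hp] [fus_fin hs].
have := hp us; have := hs p; move: fp_fin fus_fin; have [fN _] := fp.
move: (fN p) (fN us); case: (f p) => // r _; case: (f us) => // r' _ _ _.
rewrite -!EFinD !lee_fin.
have -> : us - p = - (p - us) by rewrite opprB.
set x := p - us => h1 h2.
have -> : u - us - x - herm D *m rscale tau (l - ls) =
    (u - rscale tau (herm D *m l) - p) + rscale tau (herm D *m ls).
  rewrite mulmx_rscale mulmxBr rscaleBr /x.
  by apply/matrixP => i j; rewrite !mxE; ring.
rewrite rinnerDr rinnerZr.
move: h1 h2; rewrite !rinnerNl !rinnerNr rinnerZl !(rinnerC _ x) => h1 h2.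
have h : rinner x (herm D *m ls) + tau^-1 * rinner x
    (u - rscale tau (herm D *m l) - p) >= 0 by lra.
rewrite -(pmulr_rge0 _ tau0) in h; move: h.
by rewrite mulrDr mulrA divff ?gt_eqF // mul1r addrC.
Qed.

End ProximalStep.

(** * One step with a changing stepsize *)

Section InexactStep.
Variables (R : realType) (n m : nat) (D : 'M[R[i]]_(m, n)) (theta : R).
Hypothesis theta_gt0 : 0 < theta.
Local Notation vec k := 'cV[R[i]]_k.
Local Notation M := (gram D theta).
Local Notation Q := (pdform D theta).

(* The stepsize change perturbs the firmly nonexpansive step by a term of
   size [k - 1], with [k] the ratio of consecutive stepsizes. *)
Lemma pdform_step c : exists2 C, 0 <= C &
  forall (A A' : vec n) (B G : vec m) w k, 0 < w <= 1 -> `|k - 1| <= c * w ->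
    0 <= rinner A' (A - A' - herm D *m B) ->
    M *m G = D *m (A' + (A' - A)) ->
    Q A' (B + G + rscale (k - 1) (B + invmx M *m (D *m (A' - A))))
      <= (1 + C * w) * Q A B - Q (A' - A) G.
Proof.
have [K K0 HK] := pdform_bounds D theta_gt0.
have [L L0 HL] := sqn_mulmx_bounded (invmx M).
set K2 := K * (2 * K + 2 * (L * K)).
have K20 : 0 <= K2 by rewrite /K2 mulr_ge0 // addr_ge0 ?mulr_ge0.
exists (1 + 2 * c ^+ 2 * K2) => [|A A' B G w k /andP[w0 w1] hk mono HG].
  by rewrite addr_ge0 ?(mulr_ge0 _ K20) ?(mulr_ge0 _ (sqr_ge0 c)).
have firm := pdform_firm mono HG.
set q := Q A B in firm *; set d := Q (A' - A) G in firm *.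
have q'0 := pdform_ge0 D theta A' (B + G).
have d0 : 0 <= d by exact: pdform_ge0.
have dq : d <= q by lra.
(* The direction in which the multiplier error moves when the ratio 1 is replaced by [k]; its size
   is controlled by the energy before the step. *)
set W := B + invmx M *m _.
have W_le : Q 0 W <= K2 * q.
  have [_ _ _ _ h0] := HK 0 W; apply: (le_trans h0).
  rewrite {1}/sqn /rinner mulmx0 mxE /= add0r -/(sqn W) /K2 -mulrA ler_wpM2l //.
  apply: (le_trans (sqnD_le _ _)).
  have [_ hB _ _ _] := HK A B; have [_ _ hD _ _] := HK (A' - A) G.
  have : sqn (invmx M *m (D *m (A' - A))) <= L * K * q.
    apply: (le_trans (HL _)); rewrite -mulrA ler_wpM2l //.
    by apply: (le_trans hD); rewrite ler_wpM2l.
  rewrite -/q in hB; lra.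
have := pdformD_young D theta A' (B + G) 0 (rscale (k - 1) W) w0.
rewrite addr0; have -> : Q 0 (rscale (k - 1) W) = (k - 1) ^+ 2 * Q 0 W.
  by rewrite -pdformZ /rscale scaler0.
move=> h; apply: (le_trans h).
have k2 : (k - 1) ^+ 2 <= c ^+ 2 * w ^+ 2.
  by rewrite -exprMn -real_normK ?num_real // ler_sqr ?nnegrE // (le_trans _ hk).
have e1 : (k - 1) ^+ 2 * Q 0 W <= c ^+ 2 * w ^+ 2 * (K2 * q).
  by apply: ler_pM => //; rewrite ?sqr_ge0 // pdform_ge0.
have wi0 : 0 <= 1 + w^-1 by rewrite addr_ge0 // invr_ge0 ltW.
have e2 : (1 + w^-1) * ((k - 1) ^+ 2 * Q 0 W) <= 2 * w * (c ^+ 2 * (K2 * q)).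
  apply: (le_trans (ler_wpM2l wi0 e1)).
  have -> : (1 + w^-1) * (c ^+ 2 * w ^+ 2 * (K2 * q))
      = (w ^+ 2 + w) * (c ^+ 2 * (K2 * q)) by field; rewrite gt_eqF.
  apply: ler_wpM2r; last by nra.
  by rewrite mulr_ge0 ?sqr_ge0 // mulr_ge0 // (le_trans d0).
have e3 : (1 + w) * Q A' (B + G) <= (1 + w) * (q - d).
  by apply: ler_wpM2l; lra.
have wd : 0 <= w * d by rewrite mulr_ge0 // ltW.
move: e2 e3; move: (_ * (_ * Q 0 W)) => z; lra.
Qed.

End InexactStep.

Lemma summable_partial_sums (R : realType) (w : nat -> R) :
  (forall t, 0 <= w t) -> (\sum_(0 <= t <oo) (w t)%:E < +oo)%E ->
  exists S, forall N, \sum_(0 <= t < N) w t <= S.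
Proof.
move=> w0 fin.
have le N : ((\sum_(0 <= t < N) w t)%:E <= \sum_(0 <= t <oo) (w t)%:E)%E.
  rewrite -sumEFin; apply: nneseries_lim_ge => t _ _.
  by rewrite lee_fin.
case: (\sum_(0 <= t <oo) (w t)%:E)%E fin le => [S _ le|//|_ le].
  by exists S => N; rewrite -lee_fin.
by have := le 0%N; rewrite leeNy_eq.
Qed.

Lemma eta_of_bounds (R : realType) (lo hi num den : R) :
  lo < hi -> lo <= eta_of lo hi num den <= hi.
Proof.
move=> /ltW lohi.
have clamp_bounds s : lo <= clamp lo hi s <= hi.
  by rewrite /clamp le_min ge_min le_max !lexx lohi !orbT.
by rewrite /eta_of; case: ifP => // _; case: ifP => // _; rewrite lohi lexx.
Qed.

(** * Convergence of the iterates *)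

Section ABALConvergence.
Local Open Scope classical_set_scope.
Variables (R : realType) (n m : nat).
Local Notation vec k := 'cV[R[i]]_k.
Variables (f : vec n -> \bar R) (D : 'M[R[i]]_(m, n)) (b : vec m).
Hypotheses (f_proper : proper_fun f) (f_convex : convex_fun f).
Hypothesis f_closed : closed_fun f.
Variables (omega : nat -> R) (theta lo hi : R).
Hypothesis omega_bounds : forall t, 0 < omega t <= 1.
Variable S : R.
Hypothesis omega_sum : forall N, \sum_(0 <= t < N) omega t <= S.
Hypotheses (theta_gt0 : 0 < theta) (lo_gt0 : 0 < lo) (lo_lt_hi : lo < hi).
Variables (u : nat -> vec n) (lam : nat -> vec m) (tau : nat -> R).
Hypothesis tau0_gt0 : 0 < tau 0%N.
Hypothesis uP : ABAL f D b omega theta lo hi u lam tau.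

Definition kkt us ls := D *m us = b /\ subgrad f us (- (herm D *m ls)).

Lemma kkt_optimal us ls : kkt us ls -> optimal f D b us.
Proof.
move=> [Dus [_ sg]]; split=> // v Dv; have := sg v.
by rewrite rinnerNl rinner_adj hermK mulmxBr Dus Dv subrr /rinner mulmx0 mxE oppr0 adde0.
Qed.

Local Notation M := (gram D theta).
Local Notation Q := (pdform D theta).
Local Notation energy us ls t := (Q (u t - us) (rscale (tau t) (lam t - ls))).

(** The second argument is the scaled multiplier increment of a step with ratio 1. No KKT pair
    occurs here, so decay obtained relative to one pair is a fact about the iterates alone. *)
Let defect t := Q (u t.+1 - u t) (invmx M *m (D *m (u t.+1 + (u t.+1 - u t)) - b)).

Let omega_ge0 t : 0 <= omega t.
Proof. by case/andP: (omega_bounds t) => /ltW. Qed.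

(** [kappa] is a convex combination of 1 and [eta], hence at least [Num.min lo 1], and
    [kappa - 1 = omega t * (eta - 1)]. *)
Lemma stepsize_ratio t : exists k, [/\ tau t.+1 = k * tau t,
  Num.min lo 1 <= k, `|k - 1| <= (1 + hi) * omega t, is_prox (tau t) f
    (u t - rscale (tau t) (herm D *m lam t)) (u t.+1) &
  lam t.+1 = lam t + rscale (tau t.+1)^-1
    (invmx M *m (D *m (u t.+1 + rscale k (u t.+1 - u t)) - b))].
Proof.
have [] := uP t.
have := eta_of_bounds (normv (u t.+1)) (normv (col_mx (u t.+1 -
  (u t - rscale (tau t) (herm D *m lam t))) (rscale (theta * tau t) (lam t)))) lo_lt_hi.
move: (eta_of _ _ _ _) => eta /andP[e1 e2] prox tauS lamS.
have /andP[w0 w1] := omega_bounds t.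
exists (1 - omega t + omega t * eta); split => //.
- have m1 : Num.min lo 1 <= 1 by rewrite ge_min lexx orbT.
  have m2 : Num.min lo 1 <= lo by rewrite ge_min lexx.
  have := ler_wpM2l (ltW w0) (le_trans m2 e1).
  have := ler_wpM2l (etrans (subr_ge0 _ _) w1) m1; lra.
- have -> : 1 - omega t + omega t * eta - 1 = (eta - 1) * omega t by ring.
  rewrite normrM (gtr0_norm w0); apply: ler_wpM2r; first exact: ltW.
  have eta0 := le_trans (ltW lo_gt0) e1; have hi0 := le_trans eta0 e2.
  by rewrite ler_norml; apply/andP; split; lra.
Qed.

Let lo1_gt0 : 0 < Num.min lo 1.
Proof. by rewrite lt_min lo_gt0 ltr01. Qed.

Lemma tau_gt0 t : 0 < tau t.
Proof.
elim: t => // t IH; have [k [-> k0 _ _ _]] := stepsize_ratio t.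
by rewrite mulr_gt0 // (lt_le_trans _ k0).
Qed.

(** [summable_growth] is applied to [tau] and to its inverse; for the latter,
    [k^-1 = 1 + (1 - k) / k] with [k] at least [Num.min lo 1]. *)
Lemma tau_bounded : exists2 T, 0 < T & forall t, tau t <= T /\ (tau t)^-1 <= T.
Proof.
have hi0 : 0 <= 1 + hi by rewrite addr_ge0 // ltW // (lt_trans lo_gt0).
have hlo : 0 <= (1 + hi) / Num.min lo 1 by rewrite divr_ge0 // ltW.
have [P P0 HP] := summable_growth omega_ge0 omega_sum hi0.
have [P' P'0 HP'] := summable_growth omega_ge0 omega_sum hlo.
exists (P * tau 0%N + P' * (tau 0%N)^-1) => [|t].
  by rewrite addr_gt0 ?mulr_gt0 ?invr_gt0.
have t0 := tau_gt0.
have h1 : tau t <= P * tau 0%N.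
  apply: HP => // j; first exact: ltW.
  have [k [-> _ kb _ _]] := stepsize_ratio j.
  apply: ler_wpM2r; first exact: ltW.
  by have := ler_norm (k - 1); lra.
have h2 : (tau t)^-1 <= P' * (tau 0%N)^-1.
  apply: (HP' (fun j => (tau j)^-1)) => // j; first by rewrite invr_ge0 ltW.
  have [k [-> k0 kb _ _]] := stepsize_ratio j.
  have kp : 0 < k by exact: lt_le_trans k0.
  rewrite invfM; apply: ler_wpM2r; first by rewrite invr_ge0 ltW.
  rewrite -(ler_pM2l kp) divff ?gt_eqF //.
  have : (1 + hi) * omega j <= k * ((1 + hi) / Num.min lo 1 * omega j).
    have -> : k * ((1 + hi) / Num.min lo 1 * omega j) =
      (k / Num.min lo 1) * ((1 + hi) * omega j) by ring.
    by apply: ler_peMl; rewrite ?mulr_ge0 // ler_pdivlMr // mul1r.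
  by have := ler_norm (1 - k); rewrite distrC; lra.
have := mulr_gt0 P0 (t0 0%N); have : 0 < P' * (tau 0%N)^-1.
  by rewrite mulr_gt0 ?invr_gt0.
by split; lra.
Qed.

Lemma energy_descent : exists2 C, 0 <= C & forall us ls, kkt us ls ->
  forall t, energy us ls t.+1 <= (1 + C * omega t) * energy us ls t - defect t.
Proof.
have [C C0 HC] := pdform_step D theta_gt0 (1 + hi).
exists C => // us ls [Dus sg] t.
have [k [tauS _ kb prox lamS]] := stepsize_ratio t.
have mono := prox_kkt_monotone f_proper f_convex (tau_gt0 t) prox sg.
have Munit := gram_unit D theta_gt0.
pose G := invmx M *m (D *m (u t.+1 + (u t.+1 - u t)) - b).
have diffE : (u t.+1 - us) - (u t - us) = u t.+1 - u t by rewrite opprB addrA subrK.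
have HG : M *m G = D *m ((u t.+1 - us) + ((u t.+1 - us) - (u t - us))).
  rewrite /G mulKVmx // diffE -Dus -mulmxBr; congr (_ *m _).
  by apply/matrixP => i j; rewrite !mxE; ring.
have := HC _ _ _ _ _ _ (omega_bounds t) kb mono HG.
rewrite diffE -/(defect t); congr (Q _ _ <= _).
(* Scaling by the new stepsize cancels its inverse in the update, and the new error becomes
   [B + G + (k - 1) W] in the notation of [pdform_step]. *)
rewrite lamS tauS (_ : lam t + _ - ls = (lam t - ls) + rscale (k * tau t)^-1
    (invmx M *m (D *m (u t.+1 + rscale k (u t.+1 - u t)) - b))); last first.
  by rewrite addrAC.
have kt0 : k * tau t != 0 by rewrite -tauS gt_eqF ?tau_gt0.
rewrite (rscaleDr (k * tau t)) rscaleA (divff kt0) rscale1.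
have -> y : rscale (k - 1) y = rscale k y - y :> vec m.
  by rewrite /rscale rmorphB rmorph1 scalerBl scale1r.
have MD x y : invmx M *m (D *m (u t.+1 + x) - y) =
    invmx M *m (D *m u t.+1) + invmx M *m (D *m x) - invmx M *m y.
  by rewrite mulmxBr !mulmxDr.
rewrite /G !MD !mulmx_rscale -rscaleA rscaleDr.
move: (rscale (tau t) _) (invmx M *m _) (invmx M *m _) (invmx M *m b) => X p q r.
move: (rscale k X) (rscale k q) => Y z.
by apply/matrixP => i j; rewrite !mxE; ring.
Qed.

(** For fixed [v] with finite value, each subgradient inequality places a point over [us j] in the
    epigraph, which is closed. Finiteness of [f p] comes from a [v] in the domain. *)
Lemma subgrad_limit (us : nat -> vec n) (gs : nat -> vec n) p g :
  (forall j, subgrad f (us j) (gs j)) ->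
  (fun j => sqn (us j - p)) @ \oo --> (0 : R) ->
  (fun j => sqn (gs j - g)) @ \oo --> (0 : R) ->
  subgrad f p g.
Proof.
move=> sg cu cg.
have key v r : f v = r%:E -> (f p <= (r - rinner g (v - p))%:E)%E.
  move=> fv; apply: (f_closed (s := us) (r := fun j => r - rinner (gs j) (v - us j))).
  - exact: vconverges_sqn.
  - apply: cvg_eps; apply: cvgB; first exact: cvg_cst.
    apply: cvg_rinner => //; apply: cvg0_squeeze cu => j.
    have -> : v - us j - (v - p) = - (us j - p).
      by rewrite !opprB addrC addrA subrK.
    by rewrite sqnN sqn_ge0 lexx.
  - move=> j; have [_ /(_ v)] := sg j; rewrite fv.
    by case: (f (us j)) => [y| |] //; rewrite -?EFinD ?lee_fin ?leNye // lerBrDr.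
have [fN [w0 fw0]] := f_proper.
split=> [|v].
  move: (fN w0) fw0 (key w0); case: (f w0) => // r _ _ /(_ r erefl) h.
  exact: le_lt_trans h (ltry _).
move: (fN v) (key v); case: (f v) => [r| |] // _; last by rewrite leey.
move=> /(_ r erefl); case: (f p) => [y| |] //; last by move=> _; rewrite /= leNye.
by rewrite -EFinD !lee_fin lerBrDr.
Qed.

Lemma ABAL_cvg us ls : kkt us ls ->
  exists p, optimal f D b p /\ vconverges u p.
Proof.
move=> us_kkt.
have [C C0 HC] := energy_descent.
have [P P0 HP] := summable_growth omega_ge0 omega_sum C0.
have [T T0 HT] := tau_bounded.
have [K K0 HK] := pdform_bounds D theta_gt0.
have [K1 K10 HK1] := sqn_mulmx_bounded (herm D).
have [K2 K20 HK2] := sqn_mulmx_bounded D.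
have defect_ge0 t : 0 <= defect t by exact: pdform_ge0.
have growth p q : kkt p q -> forall N t, (N <= t)%N ->
    energy p q t <= P * energy p q N.
  move=> pq N t Nt; apply: (HP (fun t => energy p q t)) => // {Nt}t.
    exact: pdform_ge0.
  by apply: (le_trans (HC _ _ pq t)); rewrite gerBl.
have defect0 : defect @ \oo --> (0 : R).
  apply: (summable_descent omega_ge0 omega_sum C0 _ defect_ge0 (HC _ _ us_kkt)).
  by move=> t; exact: pdform_ge0.
have tau2 t : (tau t)^-1 ^+ 2 <= T ^+ 2 /\ tau t ^+ 2 <= T ^+ 2.
  have t0 := ltW (tau_gt0 t); have [h1 h2] := HT t.
  by split; rewrite ler_sqr ?nnegrE ?invr_ge0 // ltW.
have step0 : (fun t => sqn (u t.+1 - u t)) @ \oo --> (0 : R).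
  apply: cvg0_squeeze (cvg0_comb K 0 defect0 defect0) => t; rewrite sqn_ge0 mul0r addr0.
  by have [] := HK (u t.+1 - u t) (invmx M *m (D *m (u t.+1 + (u t.+1 - u t)) - b)).
have feas0 : (fun t => sqn (D *m u t.+1 - b)) @ \oo --> (0 : R).
  apply: cvg0_squeeze (cvg0_comb (2 * K) (2 * K) defect0 defect0) => t.
  rewrite sqn_ge0 /=.
  set G := invmx M *m (D *m (u t.+1 + (u t.+1 - u t)) - b).
  (* By definition [M *m G] is the residual at the extrapolated point, so the true residual differs
     from it by [D] applied to the last step. *)
  have -> : D *m u t.+1 - b = M *m G - D *m (u t.+1 - u t).
    rewrite /G mulKVmx ?gram_unit // mulmxDr.
    by rewrite addrAC addrK.
  apply: (le_trans (sqnB_le _ _)).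
  have [_ _ h1 h2 _] := HK (u t.+1 - u t) G; rewrite -!mulrA.
  by apply: lerD; apply: ler_wpM2l.
pose B0 := K * (P * energy us ls 0%N).
have EB t : sqn (u t - us) <= B0 /\ sqn (rscale (tau t) (lam t - ls)) <= B0.
  have [h1 h2 _ _ _] := HK (u t - us) (rscale (tau t) (lam t - ls)).
  have h := ler_wpM2l K0 (growth _ _ us_kkt 0%N t (leq0n _)).
  by split; [exact: le_trans h1 h | exact: le_trans h2 h].
(* [u t.+1] is paired with [lam t] because the proximal optimality condition links these two. *)
have [|phi [l [hphi lcvg]]] := @bounded_cvg_extraction R _
    (fun t => col_mx (u t.+1) (lam t))
    ((2 * B0 + 2 * sqn us) + (2 * (T ^+ 2 * B0) + 2 * sqn ls)).
  move=> t; rewrite sqn_col_mx; apply: lerD.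
    rewrite -[u t.+1](subrK us); apply: (le_trans (sqnD_le _ _)).
    by have [h _] := EB t.+1; lra.
  rewrite -[lam t](subrK ls); apply: (le_trans (sqnD_le _ _)).
  have [_ h] := EB t.
  have -> : lam t - ls = rscale (tau t)^-1 (rscale (tau t) (lam t - ls)).
    by rewrite rscaleA mulVf ?rscale1 // gt_eqF ?tau_gt0.
  rewrite sqnZ lerD2r ler_wpM2l //; apply: ler_pM => //; rewrite ?sqr_ge0 ?sqn_ge0 //.
  by have [] := tau2 t.
pose p := usubmx l; pose q := dsubmx l.
have split_l j : sqn (col_mx (u (phi j).+1) (lam (phi j)) - l)
    = sqn (u (phi j).+1 - p) + sqn (lam (phi j) - q).
  by rewrite -sqn_col_mx -[in LHS](vsubmxK l) opp_col_mx add_col_mx.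
have ucvg : (fun j => sqn (u (phi j).+1 - p)) @ \oo --> (0 : R).
  by apply: cvg0_squeeze lcvg => j; rewrite split_l sqn_ge0 lerDl sqn_ge0.
have lamcvg : (fun j => sqn (lam (phi j) - q)) @ \oo --> (0 : R).
  by apply: cvg0_squeeze lcvg => j; rewrite split_l sqn_ge0 lerDr sqn_ge0.
have stepphi := cvg0_comp hphi step0; have feasphi := cvg0_comp hphi feas0.
have pq_kkt : kkt p q.
  split.
    apply/eqP; rewrite -subr_eq0; apply/eqP/sqn_eq0.
    have : (fun _ : nat => sqn (D *m p - b)) @ \oo --> (0 : R).
      apply: cvg0_squeeze (cvg0_comb 2 (2 * K2) feasphi ucvg) => j.
      rewrite sqn_ge0 /=.
      have -> : D *m p - b = (D *m u (phi j).+1 - b) - D *m (u (phi j).+1 - p).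
        by rewrite mulmxBr opprB [RHS]addrC addrA subrK.
      apply: (le_trans (sqnB_le _ _)); rewrite -mulrA lerD2l ler_wpM2l //.
    by move=> /(cvg_unique _ (cvg_cst _)); apply.
  (* The proximal subgradients are [- (herm D *m lam t)] minus the last step divided by [tau t]; the
     latter vanishes as the inverse stepsizes are bounded. *)
  apply: (@subgrad_limit (fun j => u (phi j).+1) (fun j => rscale (tau (phi j))^-1
    (u (phi j) - rscale (tau (phi j)) (herm D *m lam (phi j)) - u (phi j).+1))) => //.
    move=> j; have [k [_ _ _ prox _]] := stepsize_ratio (phi j).
    exact: prox_subgrad (tau_gt0 _) prox.
  apply: cvg0_squeeze (cvg0_comb (2 * T ^+ 2) (2 * K1) stepphi lamcvg) => j.
  rewrite sqn_ge0 /=; set t := phi j.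
  have -> : rscale (tau t)^-1 (u t - rscale (tau t) (herm D *m lam t) - u t.+1)
      - - (herm D *m q) = - (rscale (tau t)^-1 (u t.+1 - u t)) - herm D *m (lam t - q).
    have t0 : tau t != 0 by rewrite gt_eqF ?tau_gt0.
    rewrite !rscaleBr rscaleA mulVf // rscale1 mulmxBr.
    move: (rscale _ _) (rscale _ _) (_ *m _) (_ *m _) => x y z v.
    by apply/matrixP => i1 i2; rewrite !mxE; ring.
  apply: (le_trans (sqnB_le _ _)); rewrite sqnN sqnZ -!(mulrA 2); apply: lerD.
    rewrite ler_wpM2l //; apply: ler_wpM2r; first exact: sqn_ge0.
    by have [] := tau2 t.
  by rewrite ler_wpM2l.
exists p; split; first exact: kkt_optimal pq_kkt.
(* The energy at [phi j] involves [u (phi j)], whereas the extraction controls [u (phi j).+1]; the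
   vanishing steps bridge the shift. *)
have Ecvg : (fun j => energy p q (phi j)) @ \oo --> (0 : R).
  apply: cvg0_squeeze (cvg0_comb (K * 2) 1 (cvg0_comb 1 1 stepphi ucvg)
    (cvg0_comb (K * T ^+ 2) 0 lamcvg lamcvg)) => j.
  rewrite pdform_ge0 /= !mul1r mul0r addr0; set t := phi j.
  have [_ _ _ _ h] := HK (u t - p) (rscale (tau t) (lam t - q)).
  apply: (le_trans h); rewrite -!(mulrA K) -mulrDr ler_wpM2l // sqnZ; apply: lerD.
    have -> : u t - p = (u t.+1 - p) - (u t.+1 - u t).
      by rewrite opprB [RHS]addrC addrA subrK.
    by apply: (le_trans (sqnB_le _ _)); lra.
  by apply: ler_wpM2r; rewrite ?sqn_ge0 //; have [] := tau2 t.
apply: vconverges_sqn; apply/cvgrPdist_lt => e e0.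
(* One index [phi N] with small energy suffices: [growth] relative to the limit pair carries the
   bound to every later [t]. *)
have [N hN] := cvg_eps (cvg0_comb (K * P) 0 Ecvg Ecvg) e0.
exists (phi N) => // t /= Nt; rewrite sub0r normrN ger0_norm ?sqn_ge0 //.
apply: le_lt_trans (hN N (leqnn _)); rewrite mul0r addr0 subr0.
apply: le_trans (ler_norm _); rewrite -mulrA.
have [h _ _ _ _] := HK (u t - p) (rscale (tau t) (lam t - q)).
exact: le_trans h (ler_wpM2l K0 (growth _ _ pq_kkt _ _ Nt)).
Qed.

End ABALConvergence.

Theorem theorem1 (R : realType) (n m : nat)
  (f : 'cV[R[i]]_n -> \bar R) (D : 'M[R[i]]_(m, n)) (b : 'cV[R[i]]_m)
  (hproper : proper_fun f) (hconvex : convex_fun f) (hclosed : closed_fun f)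
  (hKKT : exists (us : 'cV[R[i]]_n) (ls : 'cV[R[i]]_m),
      D *m us = b /\ exists g, subgrad f us g /\ g + herm D *m ls = 0)
  (omega : nat -> R)
  (homega : forall t, 0 < omega t <= 1)
  (homega0 : omega 0%N = 1)
  (hsum : (\sum_(0 <= t <oo) (omega t)%:E < +oo)%E)
  (u0 : 'cV[R[i]]_n) (lam0 : 'cV[R[i]]_m) (tau_init theta lo hi : R)
  (htau : 0 < tau_init) (htheta : 0 < theta) (hlo : 0 < lo) (hlohi : lo < hi)
  (u : nat -> 'cV[R[i]]_n) (lam : nat -> 'cV[R[i]]_m) (tau : nat -> R)
  (hu0 : u 0%N = u0) (hlam0 : lam 0%N = lam0) (htau0 : tau 0%N = tau_init)
  (hABAL : ABAL f D b omega theta lo hi u lam tau) :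
  exists ustar : 'cV[R[i]]_n, optimal f D b ustar /\ vconverges u ustar.
Proof.
have omega_ge0 t : 0 <= omega t by case/andP: (homega t) => /ltW.
have [S hS] := summable_partial_sums omega_ge0 hsum.
have [us [ls [Dus [g [sg /eqP]]]]] := hKKT.
rewrite addr_eq0 => /eqP gE; rewrite gE in sg.
have tau0 : 0 < tau 0%N by rewrite htau0.
exact: (ABAL_cvg hproper hconvex hclosed homega hS htheta hlo hlohi tau0 hABAL
  (conj Dus sg)).
Qed.
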